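(* Let $X$ be the support of a rational fan. There is a ring isomorphism \[ \underline{\mathrm{PE}}(X)\cong \frac{\mathbb{Z}\{\mathrm{PL}(X)\}}{\mathbb{Z}\big\{\{f\}+\{g\}-\{\max(f,g)\}-\{\min(f,g)\},\ \{f+\ell\}-\{f\}\;\big|\; f,g\in\mathrm{PL}(X),\ \ell\in\mathrm{L}(X)\big\}}, \] induced by $\{f\}\mapsto [e^f]$, where $\mathbb{Z}\{\cdot\}$ in the denominator denotes the $\mathbb{Z}$-linear span (which is an ideal).
   Context: $N$ is a free abelian group of rank $n$, $N_\mathbb{R}=N\otimes\mathbb{R}$, $M=\mathrm{Hom}(N,\mathbb{Z})$, viewed as integral linear functions on $N_\mathbb{R}$. For a rational fan $\Sigma$, $\mathrm{PL}(\Sigma)$ is the group of functions $f:|\Sigma|\to\mathbb{R}$ such that on each cone $\sigma$, $f|_\sigma=m|_\sigma$ for some $m\in M$. For $X$ the support of a rational fan, $\mathrm{PL}(X)$ is the set of functions $X\to\mathbb{R}$ lying in $\mathrm{PL}(\Sigma)$ for some rational fan with $|\Sigma|=X$ (a group, closed under pointwise $\max,\min$); $\mathrm{L}(X)$ is the subgroup of restrictions $m|_X$, $m\in M$. $\mathrm{PE}(X)$ is the subring of real-valued functions on $X$ generated by $e^f$, $f\in\mathrm{PL}(X)$, and $\underline{\mathrm{PE}}(X)=\mathrm{PE}(X)/\langle e^\ell-1\mid\ell\in\mathrm{L}(X)\rangle$. $\mathbb{Z}\{\mathrm{PL}(X)\}$ is the group ring of $\mathrm{PL}(X)$ with basis $\{f\}$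 and $\{f\}\{g\}=\{f+g\}$. *)

(* Defs.v *)
From mathcomp Require Import all_boot all_order all_algebra.
From Stdlib Require List.
From mathcomp Require Import all_classical all_reals all_analysis.
Set Implicit Arguments. Unset Strict Implicit. Unset Printing Implicit Defensive.
Import Order.TTheory GRing.Theory Num.Theory.
Local Open Scope classical_set_scope.
Local Open Scope ring_scope.

(* N = Z^n, N_R = R^n (row vectors), M = Hom(N,Z) = Z^n acting by the dot product. *)
Section Defs.
Variables (R : realType) (n : nat).

Definition lin (m : 'I_n -> int) (x : 'rV[R]_n) : R :=
  \sum_(i < n) (m i)%:~R * x ord0 i.

Definition ivec (v : 'I_n -> int) : 'rV[R]_n := \row_i (v i)%:~R.

Definition rcone (V : seq ('I_n -> int)) : set 'rV[R]_n :=
  [set x | exists c : 'I_(size V) -> R, (forall j, 0 <= c j) /\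
     x = \sum_(j < size V) c j *: ivec (nth (fun=> 0) V j)].

Definition is_rational_cone (s : set 'rV[R]_n) := exists V, s = rcone V.

Definition strongly_convex (s : set 'rV[R]_n) :=
  forall x, s x -> s (- x) -> x = 0.

Definition dotp (u x : 'rV[R]_n) : R := \sum_(i < n) u ord0 i * x ord0 i.

Definition is_face (t s : set 'rV[R]_n) :=
  exists u : 'rV[R]_n, (forall x, s x -> 0 <= dotp u x) /\
    t = s `&` [set x | dotp u x = 0].

Definition is_fan (S : seq (set 'rV[R]_n)) :=
  [/\ S <> [::],
      (forall s, List.In s S -> is_rational_cone s /\ strongly_convex s),
      (forall s t, List.In s S -> is_face t s -> List.In t S) &
      (forall s t, List.In s S -> List.In t S ->
         is_face (s `&` t) s /\ is_face (s `&` t) t)].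

Definition fan_support (S : seq (set 'rV[R]_n)) : set 'rV[R]_n :=
  [set x | exists s, List.In s S /\ s x].

Definition is_fan_support (X : set 'rV[R]_n) :=
  exists S, is_fan S /\ fan_support S = X.

Definition pt (X : set 'rV[R]_n) := {x : 'rV[R]_n | X x}.

Definition PL_fan (X : set 'rV[R]_n) (S : seq (set 'rV[R]_n)) (f : pt X -> R) :=
  forall s, List.In s S ->
    exists m : 'I_n -> int, forall x : pt X, s (sval x) -> f x = lin m (sval x).

Definition PL (X : set 'rV[R]_n) (f : pt X -> R) :=
  exists S, [/\ is_fan S, fan_support S = X & PL_fan S f].

Definition Lin (X : set 'rV[R]_n) (l : pt X -> R) :=
  exists m : 'I_n -> int, l = fun x => lin m (sval x).

Definition fexp (X : set 'rV[R]_n) (f : pt X -> R) : pt X -> R :=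
  fun x => expR (f x).

Definition subring_set (X : set 'rV[R]_n) (S : set (pt X -> R)) :=
  [/\ S (fun=> 1),
      (forall F G, S F -> S G -> S (fun x => F x - G x)) &
      (forall F G, S F -> S G -> S (fun x => F x * G x))].

Definition PE (X : set 'rV[R]_n) (F : pt X -> R) :=
  forall S : set (pt X -> R), subring_set S ->
    (forall f, PL f -> S (fexp f)) -> S F.

Definition PE_ideal (X : set 'rV[R]_n) (S : set (pt X -> R)) :=
  [/\ (forall F, S F -> PE F),
      S (fun=> 0),
      (forall F G, S F -> S G -> S (fun x => F x - G x)) &
      (forall F G, PE F -> S G -> S (fun x => F x * G x))].

(* the ideal < e^l - 1 | l in L(X) > of PE(X);
   PE_underline(X) = PE(X) / this ideal *)
Definition PE_I (X : set 'rV[R]_n) (F : pt X -> R) :=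
  forall S : set (pt X -> R), PE_ideal S ->
    (forall l, Lin l -> S (fun x => expR (l x) - 1)) -> S F.

(* The group ring Z{PL(X)}: finitely supported Z-valued functions on PL(X),
   a |-> sum_f a(f) {f}. *)
Definition grp (X : set 'rV[R]_n) (a : (pt X -> R) -> int) :=
  finite_set [set f | a f != 0] /\ (forall f, a f != 0 -> PL f).

Definition gbas (X : set 'rV[R]_n) (f : pt X -> R) : (pt X -> R) -> int :=
  fun h => if `[< h = f >] then 1 else 0.

Definition gadd (X : set 'rV[R]_n) (a b : (pt X -> R) -> int) : (pt X -> R) -> int :=
  fun h => a h + b h.

(* product in the group ring: {f}{g} = {f+g}, extended bilinearly *)
Definition gmul (X : set 'rV[R]_n) (a b : (pt X -> R) -> int) : (pt X -> R) -> int :=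
  fun h => \sum_(f \in [set: pt X -> R]) a f * b (fun x => h x - f x).

Definition Jgen (X : set 'rV[R]_n) (c : (pt X -> R) -> int) :=
  (exists f g, [/\ PL f, PL g &
     c = fun h => gbas f h + gbas g h
                  - gbas (fun x => Num.max (f x) (g x)) h
                  - gbas (fun x => Num.min (f x) (g x)) h])
  \/ (exists f l, [/\ PL f, Lin l &
     c = fun h => gbas (fun x => f x + l x) h - gbas f h]).

Definition Jspan (X : set 'rV[R]_n) (a : (pt X -> R) -> int) :=
  exists s : seq (int * ((pt X -> R) -> int)),
    (forall p, List.In p s -> Jgen p.2) /\
    a = fun h => \sum_(p <- s) p.1 * p.2 h.

Definition phi (X : set 'rV[R]_n) (a : (pt X -> R) -> int) : pt X -> R :=
  fun x => \sum_(f \in [set: pt X -> R]) (a f)%:~R * expR (f x).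

End Defs.

(* Main.v *)
Require Import Defs.
From mathcomp Require Import all_boot all_order all_algebra.
From mathcomp Require Import all_classical all_reals all_analysis.
From mathcomp Require Import ring lra.
Import Order.TTheory GRing.Theory Num.Theory.
Local Open Scope classical_set_scope.
Local Open Scope ring_scope.
Set Implicit Arguments. Unset Strict Implicit. Unset Printing Implicit Defensive.

(* Two piecewise linear functions on X are linear on the cells of a common fan
   with support X: take the hyperplane arrangement of all facets of the two given
   fans and all differences of the linear pieces, and keep the cells contained in
   a cone of each of the two fans.  Hence PL(X) is stable under sums, maxima and minima.  That the cells are
   finitely generated rational cones, and that their faces are again cells, is
   Minkowski-Weyl and Farkas, both consequences of Fourier-Motzkin elimination.

   For the kernel, move the negative terms of an exponential sum vanishing on X to
   the other side, getting sum e^(f_i) = sum e^(g_j), and sort both families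
   pointwise by means of {f} + {g} = {max(f, g)} + {min(f, g)}.  Evaluating at the
   multiples t x of a point x gives sum e^(t f_i(x)) = sum e^(t g_j(x))
   for all t >= 0, and comparing leading terms as t grows shows that the two sorted
   families coincide.  Hence Z{PL(X)} modulo the max-min relations is PE(X), and
   the relations {f + l} - {f} account for the ideal generated by the e^l - 1. *)

(** * Rational polyhedral cones *)

Lemma lin_dotp (R : realType) n (m : 'I_n -> int) (x : 'rV[R]_n) :
  lin m x = dotp (ivec R m) x.
Proof. by apply: eq_bigr => i _; rewrite mxE. Qed.

Lemma dotpC (R : realType) n (x y : 'rV[R]_n) : dotp x y = dotp y x.
Proof. by apply: eq_bigr => i _; rewrite mulrC. Qed.

Lemma dotpDl (R : realType) n (u v x : 'rV[R]_n) :
  dotp (u + v) x = dotp u x + dotp v x.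
Proof. by rewrite -big_split; apply: eq_bigr => i _; rewrite mxE mulrDl. Qed.

Lemma dotpZl (R : realType) n c (u x : 'rV[R]_n) :
  dotp (c *: u) x = c * dotp u x.
Proof. by rewrite mulr_sumr; apply: eq_bigr => i _; rewrite mxE mulrA. Qed.

Lemma dotp_suml (R : realType) n I (r : seq I) (P : pred I)
    (F : I -> 'rV[R]_n) x :
  dotp (\sum_(i <- r | P i) F i) x = \sum_(i <- r | P i) dotp (F i) x.
Proof.
apply: (big_morph (fun u => dotp u x)) => [u v|]; first exact: dotpDl.
by apply: big1 => i _; rewrite mxE mul0r.
Qed.

Lemma linZ (R : realType) n (m : 'I_n -> int) c (x : 'rV[R]_n) :
  lin m (c *: x) = c * lin m x.
Proof. by rewrite !lin_dotp dotpC dotpZl dotpC. Qed.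

Lemma linD (R : realType) n (m : 'I_n -> int) (x y : 'rV[R]_n) :
  lin m (x + y) = lin m x + lin m y.
Proof. by rewrite !lin_dotp dotpC dotpDl dotpC (dotpC y). Qed.

Lemma lin_fD (R : realType) n (p q : 'I_n -> int) (x : 'rV[R]_n) :
  lin (p + q) x = lin p x + lin q x.
Proof.
by rewrite -big_split; apply: eq_bigr => i _; rewrite /= intrD mulrDl.
Qed.

Lemma lin_fN (R : realType) n (p : 'I_n -> int) (x : 'rV[R]_n) :
  lin (- p) x = - lin p x.
Proof.
by rewrite -sumrN; apply: eq_bigr => i _; rewrite /= intrN mulNr.
Qed.

Lemma lin_f0 (R : realType) n (x : 'rV[R]_n) : lin (fun=> 0) x = 0.
Proof. by apply: big1 => i _; rewrite mul0r. Qed.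

Lemma lin_comb (R : realType) n (a b : int) (p q : 'I_n -> int) (x : 'rV[R]_n) :
  lin (fun i => a * q i - b * p i) x = a%:~R * lin q x - b%:~R * lin p x.
Proof.
rewrite !mulr_sumr -sumrB; apply: eq_bigr => i _.
by rewrite intrB !intrM mulrBl !mulrA.
Qed.

Definition unitf n (j : 'I_n) : 'I_n -> int := fun i => (i == j)%:R.

Lemma lin_unitf (R : realType) n (j : 'I_n) (x : 'rV[R]_n) :
  lin (unitf j) x = x ord0 j.
Proof.
rewrite /lin (bigD1 j) //= /unitf eqxx mul1r big1 ?addr0// => i /negbTE ->.
by rewrite mul0r.
Qed.

Definition hcone (R : realType) n (A : seq ('I_n -> int)) : set 'rV[R]_n :=
  [set x | forall h, h \in A -> 0 <= lin h x].

Lemma rcone_nil (R : realType) n (x : 'rV[R]_n) : rcone [::] x <-> x = 0.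
Proof.
split=> [[c [_ ->]]|->]; first by rewrite big_ord0.
by exists (fun=> 0); split=> //; rewrite big_ord0.
Qed.

Lemma rcone_cons (R : realType) n v V (x : 'rV[R]_n) :
  rcone (v :: V) x <-> exists2 c, 0 <= c & rcone V (x - c *: ivec R v).
Proof.
split=> [[c [c0 ->]]|[c c0 [d [d0 xE]]]].
  exists (c ord0) => //; exists (fun j => c (lift ord0 j)); split=> //.
  by rewrite big_ord_recl addrAC subrr add0r.
exists (fun j => if unlift ord0 j is Some i then d i else c); split.
  by move=> j; case: unliftP.
rewrite big_ord_recl unlift_none /= -[LHS](subrK (c *: ivec R v)) xE addrC.
by congr (_ + _); apply: eq_bigr => i _; rewrite liftK.
Qed.

(** The largest of 0 and the lower bounds will do. This chooses the coefficient of an eliminated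
    generator. *)
Lemma exists_between (R : realType) (L U : seq R) :
    (forall l u, l \in L -> u \in U -> l <= u) -> (forall u, u \in U -> 0 <= u) ->
  exists2 c, 0 <= c & (forall l, l \in L -> l <= c) /\
                      (forall u, u \in U -> c <= u).
Proof.
move=> LU U0; exists (\big[Num.max/0]_(l <- L) l).
  exact: bigmax_ge_id.
split=> [l lL|u uU]; first exact: (le_bigmax_seq 0 l predT).
rewrite big_seq; apply: bigmax_le => [|l lL]; [exact: U0 | exact: LU].
Qed.

(* Fourier-Motzkin elimination of the coefficient of each generator. *)
Lemma rcone_hcone (R : realType) n (V : seq ('I_n -> int)) :
  exists H, rcone V = hcone H :> set 'rV[R]_n.
Proof.
elim: V => [|v V [H VE]].
  (* The zero cone is cut out by the coordinates and their negatives. *)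
  exists (map (@unitf n) (enum 'I_n) ++ map (fun j => - unitf j) (enum 'I_n)).
  apply/seteqP; split=> x.
    move=> /rcone_nil -> h _; rewrite /lin big1// => i _.
    by rewrite mxE mulr0.
  move=> xH; apply/rcone_nil/rowP => j; rewrite mxE; apply/eqP.
  rewrite eq_le -oppr_ge0 -(lin_unitf j x) -lin_fN; apply/andP; split.
    by apply: xH; rewrite mem_cat (map_f (fun j => - unitf j)) ?orbT ?mem_enum.
  by apply: xH; rewrite mem_cat (map_f (@unitf n)) ?mem_enum.
pose a (h : 'I_n -> int) : int := \sum_i h i * v i.
have aE h : lin h (ivec R v) = (a h)%:~R.
  by rewrite [RHS]raddf_sum; apply: eq_bigr => i _; rewrite mxE /= intrM.
have linB h c x : lin h (x - c *: ivec R v) = lin h x - c * (a h)%:~R :> R.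
  by rewrite linD -scaleNr linZ aE mulNr.
pose pos := [seq p <- H | 0 < a p]; pose neg := [seq q <- H | a q < 0].
(* Membership of [x] asks for some [c >= 0] with [c * a h <= lin h x] for all [h] in [H]: an upper
   bound on [c] if [a h > 0], a lower bound if [a h < 0]. The first list makes the upper bounds
   nonnegative and keeps the [h] with [a h = 0]; the second puts every lower bound below every upper
   bound. *)
exists ([seq h <- H | 0 <= a h] ++
        [seq (fun i => a p * q i - a q * p i) | p <- pos, q <- neg]).
apply/seteqP; split=> x.
  move=> /rcone_cons[c c0]; rewrite VE => xH h; rewrite mem_cat => /orP[|].
    rewrite mem_filter => /andP[ah hH]; have := xH h hH; rewrite linB subr_ge0.
    by apply: le_trans; rewrite mulr_ge0 ?ler0z.
  case/allpairsP => -[p q] /= [pP qN ->]; rewrite lin_comb.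
  move: pP qN; rewrite !mem_filter => /andP[ap pH] /andP[aq qH].
  have := xH p pH; have := xH q qH; rewrite !linB => Q P.
  move: ap aq; rewrite -(ltr0z R) -(ltrz0 R) => ap aq; nra.
move=> xH; have {xH} [x1 x2] : (forall h, h \in H -> 0 <= a h -> 0 <= lin h x) /\
   (forall p q, p \in pos -> q \in neg ->
     0 <= (a p)%:~R * lin q x - (a q)%:~R * lin p x).
  split=> [h hH ah|p q pP qN]; first by rewrite xH// mem_cat mem_filter ah hH.
  rewrite -lin_comb xH// mem_cat; apply/orP; right.
  by apply/allpairsP; exists (p, q).
have [||c c0 [cL cU]] := @exists_between R
    [seq lin q x / (a q)%:~R | q <- neg] [seq lin p x / (a p)%:~R | p <- pos].
- move=> _ _ /mapP[q qN ->] /mapP[p pP ->]; have := x2 p q pP qN.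
  move: pP qN; rewrite !mem_filter -(ltr0z R) -(ltrz0 R).
  move=> /andP[ap _] /andP[aq _]; rewrite subr_ge0 => le_pq.
  rewrite ler_pdivlMr// mulrAC ler_ndivrMr// [X in X <= _]mulrC.
  by rewrite [X in _ <= X]mulrC.
- move=> _ /mapP[p + ->]; rewrite mem_filter => /andP[ap pH].
  by rewrite divr_ge0 ?x1 ?ler0z ?ltW.
apply/rcone_cons; exists c => //; rewrite VE => h hH; rewrite linB subr_ge0.
have [ah|ah|ah] := ltgtP (a h) 0.
- have := cL _ (map_f _ (_ : h \in neg)); rewrite mem_filter ah hH => /(_ isT).
  by rewrite ler_ndivrMr ?ltrz0.
- have := cU _ (map_f _ (_ : h \in pos)); rewrite mem_filter ah hH => /(_ isT).
  by rewrite ler_pdivlMr ?ltr0z.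
- by rewrite ah mulr0 x1// ah.
Qed.

Lemma rcone_dotp_ge0 (R : realType) n (A : seq ('I_n -> int)) (u x : 'rV[R]_n) :
  rcone A u -> hcone A x -> 0 <= dotp u x.
Proof.
move=> [c [c0 ->]] xA; rewrite dotp_suml sumr_ge0// => j _.
by rewrite dotpZl -lin_dotp mulr_ge0// xA// mem_nth.
Qed.

Lemma mem_rcone (R : realType) n (A : seq ('I_n -> int)) h :
  h \in A -> rcone A (ivec R h).
Proof.
move=> hA; have hs : (index h A < size A)%N by rewrite index_mem.
exists (fun j => (j == Ordinal hs)%:R); split=> [j|]; first exact: ler0n.
rewrite (bigD1 (Ordinal hs)) //= eqxx scale1r nth_index// big1 ?addr0//.
by move=> j /negbTE ->; rewrite scale0r.
Qed.

(** By elimination [rcone A] is itself cut out by some [V]. Each [v] in [V] is nonnegative on the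
    generators [A], so [ivec R v] lies in [hcone A], and the hypothesis there is the inequality of
    [v] at [u]. *)
Lemma farkas (R : realType) n (A : seq ('I_n -> int)) (u : 'rV[R]_n) :
  (forall x, hcone A x -> 0 <= dotp u x) -> rcone A u.
Proof.
have [V AE] := @rcone_hcone R n A; rewrite AE => uA v vV.
rewrite lin_dotp dotpC; apply: uA => h hA.
by rewrite lin_dotp dotpC -lin_dotp; have := mem_rcone R hA; rewrite AE; apply.
Qed.

(* Dualize twice: the facet normals of the cone generated by [A] generate its
   dual cone. *)
Lemma hcone_rational (R : realType) n (A : seq ('I_n -> int)) :
  is_rational_cone (@hcone R n A).
Proof.
have [V AE] := @rcone_hcone R n A; have [W VE] := @rcone_hcone R n V.
exists V; apply/seteqP; split=> x; last first.
  move=> xV h hA; rewrite lin_dotp dotpC; apply: rcone_dotp_ge0 xV _.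
  by rewrite -AE; exact: mem_rcone.
move=> xA; rewrite VE => w wW; rewrite lin_dotp.
apply: rcone_dotp_ge0 xA; rewrite AE => v vV.
rewrite lin_dotp dotpC -lin_dotp.
by have := mem_rcone R vV; rewrite VE; apply.
Qed.

(** * Hyperplane arrangements and common refinements *)

Lemma InP (T : eqType) (x : T) (s : seq T) : List.In x s <-> x \in s.
Proof.
elim: s => //= y s ->; rewrite inE; split=> [[->|->]|/predU1P[->|xs]].
- by rewrite eqxx.
- by rewrite orbT.
- by left.
- by right.
Qed.

(** Gathers witnesses for finitely many cones in one list, so that linear pieces and defining
    inequalities of a fan can enter an arrangement. *)
Lemma seq_choice T (Y : eqType) (s : seq T) (Q : T -> Y -> Prop) :
    (forall x, List.In x s -> exists y, Q x y) ->
  exists ys : seq Y, forall x, List.In x s -> exists2 y, y \in ys & Q x y.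
Proof.
elim: s => [|x s IHs] sQ; first by exists [::].
have [ys ysP] := IHs (fun z zs => sQ z (or_intror zs)).
have [y Qxy] := sQ x (or_introl erefl).
exists (y :: ys) => z [<-|/ysP[t tys Qt]]; first by exists y; rewrite ?mem_head.
by exists t; rewrite // inE tys orbT.
Qed.

Lemma hcone_cat (R : realType) n (A B : seq ('I_n -> int)) :
  hcone (A ++ B) = hcone A `&` hcone B :> set 'rV[R]_n.
Proof.
apply/seteqP; split=> [x xAB|x [xA xB] h].
  by split=> h hA; apply: xAB; rewrite mem_cat hA ?orbT.
by rewrite mem_cat => /orP[/xA|/xB].
Qed.

(* For [L] stable under negation, the cones [hcone A] with [cell L A] are the
   closed cells of the arrangement of hyperplanes [h = 0], [h] in [L]. *)
Definition cell n (L A : seq ('I_n -> int)) :=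
  {subset A <= L} /\ (forall h, h \in L -> h \in A \/ - h \in A).

Lemma cell_cat n (L A B : seq ('I_n -> int)) :
  cell L A -> {subset B <= L} -> cell L (A ++ B).
Proof.
move=> [AL AC] BL; split=> h; first by rewrite mem_cat => /orP[/AL|/BL].
by rewrite !mem_cat => /AC[|] ->; [left | right].
Qed.

(** By Farkas the supporting functional is a nonnegative combination of [A]. On the cone it vanishes
    exactly when every term with positive coefficient does, so adding the negatives of those [h] to
    [A] cuts out the face. *)
Lemma face_cell (R : realType) n (L A : seq ('I_n -> int)) (F : set 'rV[R]_n) :
    (forall h, h \in L -> - h \in L) -> cell L A -> is_face F (hcone A) ->
  exists2 B, cell L B & F = hcone B.
Proof.
move=> LN cA [u [/farkas uA ->]]; have [c [c0 uE]] := uA.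
pose B := [seq - nth (fun=> 0) A j | j : 'I_(size A) <- enum 'I_(size A) & 0 < c j].
exists (A ++ B).
  apply: cell_cat => // _ /mapP[j _ ->].
  by apply: LN; apply: cA.1; apply: mem_nth.
have dE x : dotp u x = \sum_j c j * lin (nth (fun=> 0) A j) x.
  by rewrite uE dotp_suml; apply: eq_bigr => j _; rewrite dotpZl lin_dotp.
rewrite hcone_cat; apply/seteqP; split=> x [xA xu]; split=> //=.
  move=> _ /mapP[j + ->]; rewrite mem_filter => /andP[cj _].
  move: xu; rewrite /= dE => xu; rewrite lin_fN oppr_ge0.
  have cA0 i : 0 <= c i * lin (nth (fun=> 0) A i) x.
    by rewrite mulr_ge0// xA// mem_nth.
  have /eqP : c j * lin (nth (fun=> 0) A j) x = 0.
    exact: (psumr_eq0P (fun i _ => cA0 i) xu).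
  by rewrite mulf_eq0 (gt_eqF cj) => /eqP ->.
rewrite dE big1// => j _; have := c0 j; rewrite le_eqVlt => /predU1P[<-|cj].
  by rewrite mul0r.
have := xu _ (map_f _ (_ : j \in [seq j <- enum 'I_(size A) | 0 < c j])).
rewrite mem_filter mem_enum cj => /(_ isT); rewrite lin_fN oppr_ge0 => ljx.
rewrite (_ : lin _ x = 0) ?mulr0//; apply/eqP.
by rewrite eq_le ljx xA// mem_nth.
Qed.

(** The supporting functional is the sum of the [h] in [A] with [- h] in [B]. Its terms are
    nonnegative on [hcone A], so it vanishes only where each of them does, and any [h] in [B]
    outside [A] is the negative of a term. *)
Lemma cellI_face (R : realType) n (L A B : seq ('I_n -> int)) :
  cell L A -> cell L B -> is_face (hcone A `&` hcone B) (@hcone R n A).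
Proof.
move=> [AL AC] [BL BC]; exists (\sum_(h <- A | - h \in B) ivec R h).
have dE x : dotp (\sum_(h <- A | - h \in B) ivec R h) x =
            \sum_(h <- A | - h \in B) lin h x.
  by rewrite dotp_suml; apply: eq_bigr => h _; rewrite lin_dotp.
split=> [x xA|].
  by rewrite dE big_seq_cond sumr_ge0// => h /andP[hA _]; exact: xA.
apply/seteqP; split=> x [xA xB]; split=> //=.
  rewrite dE big_seq_cond big1// => h /andP[hA hB]; apply/eqP.
  by rewrite eq_le xA// -oppr_ge0 -lin_fN xB.
move=> h hB; have [hA|hA] := AC h (BL h hB); first exact: xA.
have: \sum_(h <- A | - h \in B) lin h x = 0 by rewrite -dE.
move/eqP; rewrite big_seq_cond psumr_eq0; last by move=> g /andP[gA _]; apply: xA.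
move=> /allP /(_ _ hA); rewrite hA opprK hB/= lin_fN => /eqP/eqP.
by rewrite oppr_eq0 => /eqP ->.
Qed.

(** Up to order and repetition a cell is a subset of [L], so an arrangement has finitely many cells
    and they can be listed. *)
Lemma cell_mask n (L A : seq ('I_n -> int)) : cell L A ->
  exists m : (size L).-tuple bool, A =i mask m L.
Proof.
move=> [AL _]; exists [tuple of map (mem A) (in_tuple L)] => h.
by rewrite -filter_mask mem_filter /=; case: (boolP (h \in A)) => //= /AL ->.
Qed.

Lemma eq_cell (R : realType) n (L A B : seq ('I_n -> int)) : A =i B ->
  (cell L A -> cell L B) /\ hcone A = hcone B :> set 'rV[R]_n.
Proof.
move=> AB; split=> [[AL AC]|].
  by split=> h; rewrite -?AB; [exact: AL | exact: AC].
by apply/seteqP; split=> x xA h; [rewrite -AB | rewrite AB]; apply: xA.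
Qed.

(** [good] selects the cells to keep; its stability under subsets keeps their faces too. Coordinates
    in [L] fix the sign of each coordinate on a cell, which gives strong convexity. *)
Lemma cell_fan (R : realType) n (L : seq ('I_n -> int))
    (good : set 'rV[R]_n -> Prop) :
    (forall h, h \in L -> - h \in L) -> (forall j, unitf j \in L) ->
    (forall C D, C `<=` D -> good D -> good C) ->
    (exists2 A, cell L A & good (hcone A)) ->
  exists U : seq (set 'rV[R]_n), is_fan U /\
    forall C, List.In C U <-> exists A, [/\ cell L A, good (hcone A) & C = hcone A].
Proof.
move=> LN Lu goodS [A0 cA0 gA0].
pose ok (m : (size L).-tuple bool) :=
  cell L (mask m L) /\ good (hcone (mask m L)).
pose U : seq (set 'rV[R]_n) :=
  [seq hcone (mask m L) | m : (size L).-tuple bool <-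
     enum {: (size L).-tuple bool} & `[< ok m >]].
have inU C : List.In C U <-> exists A, [/\ cell L A, good (hcone A) & C = hcone A].
  rewrite InP; split=> [/mapP[m]|[A [cA gA ->]]].
    by rewrite mem_filter => /andP[/asboolP[cm gm] _ ->]; exists (mask m L).
  have [m Am] := cell_mask cA; have [cm AmE] := eq_cell R L Am.
  rewrite AmE; apply: map_f; rewrite mem_filter mem_enum andbT.
  by apply/asboolP; split; [exact: cm | rewrite -AmE].
exists U; split=> //; split.
- have : List.In (hcone A0) U by apply/inU; exists A0.
  by case: U {inU}.
- move=> _ /inU[A [[AL AC] _ ->]]; split; first exact: hcone_rational.
  move=> x xA xNA; apply/rowP => j; rewrite mxE -lin_unitf; apply/eqP.
  have lN h : lin h (- x) = - lin h x by rewrite -scaleN1r linZ mulN1r.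
  rewrite eq_le; have [/[dup] /xA -> /xNA|/[dup] /xA + /xNA] := AC _ (Lu j).
    by rewrite lN oppr_ge0 => ->.
  by rewrite lN !lin_fN opprK oppr_ge0 => -> ->.
- move=> _ F /inU[A [cA gA ->]] FA; apply/inU.
  have FsA : F `<=` hcone A by case: FA => u [_ ->]; exact: subIsetl.
  have [B cB FE] := face_cell LN cA FA; exists B; split=> //.
  by apply: goodS gA; rewrite -FE.
- move=> _ _ /inU[A [cA _ ->]] /inU[B [cB _ ->]]; split.
    exact: cellI_face cA cB.
  by rewrite setIC; exact: cellI_face cB cA.
Qed.

(** * Homogeneity, and stability of [PL] under sums, maxima and minima *)

Lemma rational_cone_scale (R : realType) n (s : set 'rV[R]_n) t x :
  is_rational_cone s -> 0 <= t -> s x -> s (t *: x).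
Proof.
move=> [V ->] t0; have [H ->] := @rcone_hcone R n V => xH h hH.
by rewrite linZ mulr_ge0// xH.
Qed.

Lemma rational_cone0 (R : realType) n (s : set 'rV[R]_n) :
  is_rational_cone s -> s 0.
Proof.
move=> [V ->]; exists (fun=> 0); split=> //.
by rewrite big1// => j _; rewrite scale0r.
Qed.

Lemma fan_support_scale (R : realType) n (X : set 'rV[R]_n) t x :
  is_fan_support X -> 0 <= t -> X x -> X (t *: x).
Proof.
move=> [S [[_ Scone _ _] <-]] t0 [s [sS sx]]; exists s; split=> //.
exact: rational_cone_scale (Scone s sS).1 t0 sx.
Qed.

Lemma fan_support0 (R : realType) n (X : set 'rV[R]_n) :
  is_fan_support X -> X 0.
Proof.
move=> [[|s S] [[// _ Scone _ _] <-]]; have sS := or_introl erefl : List.In s (s :: S).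
by exists s; split=> //; exact: rational_cone0 (Scone s sS).1.
Qed.

(** A cone containing [sval x] contains its ray, so one linear piece computes both values. *)
Lemma PL_homog (R : realType) n (X : set 'rV[R]_n) (f : pt X -> R) (x y : pt X) t :
  PL f -> 0 <= t -> sval y = t *: sval x -> f y = t * f x.
Proof.
move=> [S [[_ Scone _ _] SX fS]] t0 yE.
have : fan_support S (sval x) by rewrite SX; exact: svalP.
move=> [s [sS sx]]; have [m fm] := fS s sS.
rewrite !fm// yE ?linZ//; exact: rational_cone_scale (Scone s sS).1 t0 sx.
Qed.

Lemma PL_refine (R : realType) n (X : set 'rV[R]_n) (f g : pt X -> R) :
  PL f -> PL g ->
  exists U, [/\ is_fan U, fan_support U = X &
    forall C, List.In C U -> exists p q,
      [/\ forall x : pt X, C (sval x) -> f x = lin p (sval x),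
          forall x : pt X, C (sval x) -> g x = lin q (sval x) &
          (forall x, C x -> lin p x <= lin q x) \/
          (forall x, C x -> lin q x <= lin p x)]].
Proof.
move=> [S [Sfan SX fS]] [T [Tfan TX gT]].
have [ms msP] := seq_choice fS; have [ks ksP] := seq_choice gT.
have [Hs HsP] : exists Hs : seq (seq ('I_n -> int)),
    forall s, List.In s (S ++ T)%list -> exists2 H, H \in Hs & s = hcone H.
  apply: seq_choice => s /List.in_app_iff[sS|sT].
    by case: Sfan => _ /(_ s sS)[[V ->] _] _ _; exact: rcone_hcone.
  by case: Tfan => _ /(_ s sT)[[V ->] _] _ _; exact: rcone_hcone.
(* Coordinates give strong convexity, the inequalities in [Hs] keep the cell of a point inside the
   cones through that point, and the differences [p - q] make the two functions comparable on each
   cell. *)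
pose L0 := map (@unitf n) (enum 'I_n) ++ flatten Hs ++
           [seq p - q | p <- ms, q <- ks].
pose L := L0 ++ map -%R L0.
have LN h : h \in L -> - h \in L.
  rewrite /L !(mem_cat _ L0) => /orP[hL|/mapP[k kL ->]]; last by rewrite opprK kL.
  by rewrite (map_f -%R hL) orbT.
have L0L h : h \in L0 -> h \in L by move=> hL0; rewrite mem_cat hL0.
have Lu j : unitf j \in L by apply: L0L; rewrite mem_cat (map_f (@unitf n)) ?mem_enum.
pose good C := (exists2 s, List.In s S & C `<=` s) /\
               (exists2 t, List.In t T & C `<=` t).
(* These inequalities cut out the smallest closed cell containing [x]: an [h] vanishing at [x]
   enters with both signs. *)
pose cellat (x : 'rV[R]_n) := [seq h <- L | 0 <= lin h x].
have cellatP x : cell L (cellat x).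
  split=> [h|h hL]; rewrite !mem_filter ?hL ?LN//; first by case/andP.
  by rewrite lin_fN oppr_ge0 !andbT; exact/orP/le_total.
have cellat_sub s x : List.In s (S ++ T)%list -> s x -> hcone (cellat x) `<=` s.
  move=> /HsP[H HHs ->] xH y yx h hH; apply: yx; rewrite mem_filter xH//=.
  apply: L0L; rewrite !mem_cat (_ : h \in flatten Hs) ?orbT//.
  by apply/flattenP; exists H.
have cellat_good x : X x -> good (hcone (cellat x)).
  move=> Xx; split.
    have : fan_support S x by rewrite SX.
    move=> [s [sS sx]]; exists s => //; apply: cellat_sub => //.
    by apply/List.in_app_iff; left.
  have : fan_support T x by rewrite TX.
  move=> [s [sS sx]]; exists s => //; apply: cellat_sub => //.
  by apply/List.in_app_iff; right.
have X0 : X 0 by apply: fan_support0; exists S.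
have [| |U [Ufan inU]] := cell_fan LN Lu (good := good).
- by move=> C D CD [[s sS Ds] [t tT Dt]]; split; [exists s|exists t] => //;
    exact: subset_trans CD _.
- by exists (cellat 0); [exact: cellatP | exact: cellat_good].
exists U; split=> //.
  apply/seteqP; split=> [x [C [/inU[A [_ [[s sS As] _] ->]] xA]]|x Xx].
    by rewrite -SX; exists s; split=> //; exact: As.
  exists (hcone (cellat x)); split; last by move=> h; rewrite mem_filter => /andP[].
  by apply/inU; exists (cellat x); split=> //; exact: cellat_good.
move=> _ /inU[A [[AL AC] [[s sS As] [t tT At]] ->]].
have [p pms fp] := msP s sS; have [q qks gq] := ksP t tT.
exists p, q; split=> [x xA|x xA|]; [exact/fp/As|exact/gq/At|].
have pqL : p - q \in L.
  apply: L0L; rewrite !mem_cat (_ : p - q \in [seq _ - _ | _ <- _, _ <- _]) ?orbT//.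
  by apply/allpairsP; exists (p, q).
have [pqA|pqA] := AC _ pqL; [right|left] => x /(_ _ pqA).
  by rewrite lin_fD lin_fN subr_ge0.
by rewrite lin_fN oppr_ge0 lin_fD lin_fN subr_le0.
Qed.

Lemma PL_add (R : realType) n (X : set 'rV[R]_n) (f g : pt X -> R) :
  PL f -> PL g -> PL (fun x => f x + g x).
Proof.
move=> fPL gPL; have [U [Ufan UX Ulin]] := PL_refine fPL gPL.
exists U; split=> // C /Ulin[p [q [fp gq _]]]; exists (p + q) => x xC.
by rewrite fp// gq// lin_fD.
Qed.

Lemma PL_max (R : realType) n (X : set 'rV[R]_n) (f g : pt X -> R) :
  PL f -> PL g -> PL (fun x => Num.max (f x) (g x)).
Proof.
move=> fPL gPL; have [U [Ufan UX Ulin]] := PL_refine fPL gPL.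
exists U; split=> // C /Ulin[p [q [fp gq [pq|qp]]]]; [exists q|exists p] => x xC.
  by rewrite fp// gq//; apply/max_idPr/pq.
by rewrite fp// gq//; apply/max_idPl/qp.
Qed.

Lemma PL_min (R : realType) n (X : set 'rV[R]_n) (f g : pt X -> R) :
  PL f -> PL g -> PL (fun x => Num.min (f x) (g x)).
Proof.
move=> fPL gPL; have [U [Ufan UX Ulin]] := PL_refine fPL gPL.
exists U; split=> // C /Ulin[p [q [fp gq [pq|qp]]]]; [exists p|exists q] => x xC.
  by rewrite fp// gq//; apply/min_idPl/pq.
by rewrite fp// gq//; apply/min_idPr/qp.
Qed.

Lemma Lin_PL (R : realType) n (X : set 'rV[R]_n) (l : pt X -> R) :
  is_fan_support X -> Lin l -> PL l.
Proof. by move=> [S [Sfan SX]] [m ->]; exists S; split=> // s _; exists m. Qed.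

Lemma Lin0 (R : realType) n (X : set 'rV[R]_n) : Lin ((fun=> 0) : pt X -> R).
Proof. by exists (fun=> 0); apply/funext => x; rewrite lin_f0. Qed.

(** * Finite combinations of exponentials *)

(* The list [s] of pairs [(z, f)] encodes the element [sum z {f}] of the group
   ring; [f] may be repeated. *)
Definition gcomb (R : realType) n (X : set 'rV[R]_n) (s : seq (int * (pt X -> R))) :
    (pt X -> R) -> int :=
  fun h => \sum_(p <- s) p.1 * gbas p.2 h.

Definition ecomb (R : realType) n (X : set 'rV[R]_n) (s : seq (int * (pt X -> R))) :
    pt X -> R :=
  fun x => \sum_(p <- s) p.1%:~R * expR (p.2 x).

Definition gscale (R : realType) n (X : set 'rV[R]_n) (z : int)
    (s : seq (int * (pt X -> R))) :=
  [seq (z * p.1, p.2) | p <- s].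

Definition gprod (R : realType) n (X : set 'rV[R]_n)
    (s t : seq (int * (pt X -> R))) :=
  [seq (p.1 * q.1, (fun x => p.2 x + q.2 x) : pt X -> R) | p <- s, q <- t].

Definition PLs (R : realType) n (X : set 'rV[R]_n) (s : seq (int * (pt X -> R))) :=
  forall p, p \in s -> PL p.2.

Lemma gbasE (R : realType) n (X : set 'rV[R]_n) (f h : pt X -> R) :
  gbas f h = (h == f)%:R.
Proof. by rewrite /gbas; case: asboolP; case: eqP. Qed.

Lemma gbas_shift (R : realType) n (X : set 'rV[R]_n) (f g h : pt X -> R) :
  gbas g (fun x => h x - f x) = gbas (fun x => f x + g x) h.
Proof.
rewrite !gbasE; congr (nat_of_bool _)%:R; apply/eqP/eqP => [<-|->].
  by apply/funext => x; rewrite addrC subrK.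
by apply/funext => x; rewrite addrAC subrr add0r.
Qed.

Lemma gcomb_out (R : realType) n (X : set 'rV[R]_n) s (f : pt X -> R) :
  f \notin map snd s -> gcomb s f = 0.
Proof.
move=> fs; rewrite /gcomb big_seq big1// => p ps.
rewrite gbasE (_ : f == p.2 = false) ?mulr0//; apply/eqP => fp.
by move: fs; rewrite fp map_f.
Qed.

Lemma grp_gcomb (R : realType) n (X : set 'rV[R]_n) (a : (pt X -> R) -> int) :
  grp a -> exists2 s, PLs s & a = gcomb s.
Proof.
move=> [/finite_seqP[F FE] aPL].
have inF f : (f \in undup F) = (a f != 0).
  have E : is_true (a f != 0) = is_true (f \in F) := congr1 (fun A => A f) FE.
  by rewrite mem_undup; apply/idP/idP; rewrite E.
exists [seq (a f, f) | f <- undup F].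
  by move=> _ /mapP[f + ->]; rewrite inF; exact: aPL.
apply/funext => h; rewrite /gcomb big_map.
have [hF|] := boolP (h \in undup F).
  rewrite (bigD1_seq h) ?undup_uniq//= gbasE eqxx mulr1 big1 ?addr0// => f fh.
  by rewrite gbasE eq_sym (negbTE fh) mulr0.
move=> hF; move: (hF); rewrite inF negbK => /eqP ->; rewrite big_seq big1// => f fF.
rewrite gbasE (_ : h == f = false) ?mulr0//; apply/eqP => hf.
by move: hF; rewrite hf fF.
Qed.

Lemma gcomb_grp (R : realType) n (X : set 'rV[R]_n) (s : seq (int * (pt X -> R))) :
  PLs s -> grp (gcomb s).
Proof.
have ins f : gcomb s f != 0 -> f \in map snd s.
  by apply: contraNT => /gcomb_out ->.
move=> sPL; split; last by move=> f /ins /mapP[p ps ->]; exact: sPL.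
apply: (@sub_finite_set _ _ [set` map snd s]); first by move=> f /= /ins.
exact: finite_seq.
Qed.

(** Exchanging the sums collects repeated exponents. The ring [K] is general because [phi] sums in
    [R] and [gmul] in [int]. *)
Lemma fsum_gcomb (R : realType) n (X : set 'rV[R]_n) (K : pzRingType)
    (s : seq (int * (pt X -> R))) (c : (pt X -> R) -> K) :
  \sum_(f \in [set: pt X -> R]) (gcomb s f)%:~R * c f =
  \sum_(p <- s) p.1%:~R * c p.2.
Proof.
rewrite (fsbigE (undup (map snd s))) ?undup_uniq//; last first.
  by move=> f _; rewrite mem_undup => /gcomb_out ->; rewrite mul0r.
rewrite (eq_bigl predT) => [|f]; last exact: in_setT.
under eq_bigr do rewrite /gcomb raddf_sum mulr_suml.
rewrite exchange_big /= big_seq [RHS]big_seq; apply: eq_bigr => p ps.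
rewrite (bigD1_seq p.2) ?undup_uniq ?mem_undup ?map_f//=.
rewrite gbasE eqxx mulr1 big1 ?addr0// => f fp.
by rewrite gbasE (negbTE fp) mulr0 mul0r.
Qed.

Lemma phi_gcomb (R : realType) n (X : set 'rV[R]_n) (s : seq (int * (pt X -> R))) :
  phi (gcomb s) = ecomb s.
Proof. by apply/funext => x; rewrite /phi fsum_gcomb. Qed.

Lemma gcomb1 (R : realType) n (X : set 'rV[R]_n) (f : pt X -> R) :
  gcomb [:: (1, f)] = gbas f.
Proof. by apply/funext => h; rewrite /gcomb big_seq1 mul1r. Qed.

Lemma gcomb_cat (R : realType) n (X : set 'rV[R]_n) (s t : seq (int * (pt X -> R))) h :
  gcomb (s ++ t) h = gcomb s h + gcomb t h.
Proof. exact: big_cat. Qed.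

Lemma ecomb_cat (R : realType) n (X : set 'rV[R]_n) (s t : seq (int * (pt X -> R))) x :
  ecomb (s ++ t) x = ecomb s x + ecomb t x.
Proof. exact: big_cat. Qed.

Lemma gcomb_scale (R : realType) n (X : set 'rV[R]_n) z
    (s : seq (int * (pt X -> R))) h :
  gcomb (gscale z s) h = z * gcomb s h.
Proof.
by rewrite /gcomb big_map mulr_sumr; apply: eq_bigr => p _; rewrite mulrA.
Qed.

Lemma ecomb_scale (R : realType) n (X : set 'rV[R]_n) z
    (s : seq (int * (pt X -> R))) x :
  ecomb (gscale z s) x = z%:~R * ecomb s x.
Proof.
rewrite /ecomb big_map mulr_sumr; apply: eq_bigr => p _.
by rewrite /= intrM mulrA.
Qed.

Lemma gcomb_prod (R : realType) n (X : set 'rV[R]_n) (s t : seq (int * (pt X -> R))) h :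
  gcomb (gprod s t) h = \sum_(p <- s) p.1 * gcomb t (fun x => h x - p.2 x).
Proof.
rewrite /gcomb big_allpairs_dep; apply: eq_bigr => p _.
by rewrite mulr_sumr; apply: eq_bigr => q _; rewrite /= gbas_shift mulrA.
Qed.

Lemma gmul_gcomb (R : realType) n (X : set 'rV[R]_n) (s t : seq (int * (pt X -> R))) :
  gmul (gcomb s) (gcomb t) = gcomb (gprod s t).
Proof.
apply/funext => h; rewrite gcomb_prod /gmul.
have := @fsum_gcomb R n X int s (fun f => gcomb t (fun x => h x - f x)).
under eq_fsbigr do rewrite intz.
by under [RHS]eq_bigr do rewrite intz.
Qed.

Lemma ecomb_prod (R : realType) n (X : set 'rV[R]_n) (s t : seq (int * (pt X -> R))) x :
  ecomb (gprod s t) x = ecomb s x * ecomb t x.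
Proof.
rewrite /ecomb big_allpairs_dep mulr_suml; apply: eq_bigr => p _.
rewrite mulr_sumr; apply: eq_bigr => q _.
by rewrite /= intrM expRD mulrACA.
Qed.

Lemma PLs_cat (R : realType) n (X : set 'rV[R]_n) (s t : seq (int * (pt X -> R))) :
  PLs s -> PLs t -> PLs (s ++ t).
Proof. by move=> sPL tPL p; rewrite mem_cat => /orP[/sPL|/tPL]. Qed.

Lemma PLs_scale (R : realType) n (X : set 'rV[R]_n) z (s : seq (int * (pt X -> R))) :
  PLs s -> PLs (gscale z s).
Proof. by move=> sPL _ /mapP[p /sPL pPL ->]. Qed.

Lemma PLs_prod (R : realType) n (X : set 'rV[R]_n) (s t : seq (int * (pt X -> R))) :
  PLs s -> PLs t -> PLs (gprod s t).
Proof.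
move=> sPL tPL _ /allpairsP[[p q] /= [/sPL pPL /tPL qPL ->]]; exact: PL_add.
Qed.

(** Only zero and differences are assumed, so that it serves subrings and ideals alike. *)
Lemma subring_int (T : Type) (K : pzRingType) (S : set (T -> K)) :
    S (fun=> 0) -> (forall F G, S F -> S G -> S (fun x => F x - G x)) ->
  forall (z : int) F, S F -> S (fun x => z%:~R * F x).
Proof.
move=> S0 SB z F SF.
have SN G : S G -> S (fun x => - G x).
  by move=> SG; rewrite (_ : (fun _ => _) = (fun x => 0 - G x)); [exact: SB|
     apply/funext => x; rewrite sub0r].
have Snat k : S (fun x => k%:R * F x).
  elim: k => [|k IHk].
    by rewrite (_ : (fun _ => _) = fun=> 0)//; apply/funext => x; rewrite mul0r.
  rewrite (_ : (fun _ => _) = fun x => k%:R * F x - (- F x)).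
    by apply: SB => //; exact: SN.
  by apply/funext => x; rewrite opprK -natr1 mulrDl mul1r.
case: z => k; first exact: Snat.
rewrite (_ : (fun _ => _) = fun x => - (k.+1%:R * F x)); first exact: SN.
by apply/funext => x; rewrite NegzE mulrNz mulNr.
Qed.

Lemma subr_closed_add (T : Type) (K : pzRingType) (S : set (T -> K)) :
    S (fun=> 0) -> (forall F G, S F -> S G -> S (fun x => F x - G x)) ->
  forall F G, S F -> S G -> S (fun x => F x + G x).
Proof.
move=> S0 SB F G SF SG.
rewrite (_ : (fun _ => _) = fun x => F x - (0 - G x)).
  exact/(SB F _ SF)/(SB (fun=> 0)).
by apply/funext => x; rewrite sub0r opprK.
Qed.

(** * The ring [PE] as the set of exponential combinations *)

Lemma ecomb_PE (R : realType) n (X : set 'rV[R]_n) (s : seq (int * (pt X -> R))) :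
  PLs s -> PE (ecomb s).
Proof.
move=> sPL S [S1 SB SM] SE.
have S0 : S (fun=> 0).
  by have := SB _ _ S1 S1; rewrite subrr.
elim: s sPL => [_|p s IHs sPL].
  by rewrite (_ : ecomb _ = fun=> 0)//; apply/funext => x; rewrite /ecomb big_nil.
rewrite (_ : ecomb _ = fun x => p.1%:~R * fexp p.2 x + ecomb s x); last first.
  by apply/funext => x; rewrite /ecomb big_cons.
apply: subr_closed_add => //; last first.
  by apply: IHs => q qs; apply: sPL; rewrite inE qs orbT.
by apply: subring_int => //; apply/SE/sPL/mem_head.
Qed.

(** [PE] is the smallest subring containing the exponentials, so it suffices that the combinations
    form a subring. *)
Lemma PE_ecomb (R : realType) n (X : set 'rV[R]_n) (F : pt X -> R) :
  is_fan_support X -> PE F -> exists2 s, PLs s & F = ecomb s.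
Proof.
move=> Xfan /(_ [set G | exists2 s, PLs s & G = ecomb s]); apply; last first.
  move=> f fPL; exists [:: (1, f)]; first by move=> p /[!inE] /eqP ->.
  by apply/funext => x; rewrite /ecomb big_seq1 mul1r.
split.
- exists [:: (1, fun=> 0)].
    by move=> p /[!inE] /eqP ->; apply: Lin_PL => //; exact: Lin0.
  by apply/funext => x; rewrite /ecomb big_seq1 mul1r expR0.
- move=> _ _ [s sPL ->] [t tPL ->]; exists (s ++ gscale (-1) t).
    by apply: PLs_cat => //; exact: PLs_scale.
  by apply/funext => x; rewrite ecomb_cat ecomb_scale mulN1r.
- move=> _ _ [s sPL ->] [t tPL ->]; exists (gprod s t); first exact: PLs_prod.
  by apply/funext => x; rewrite ecomb_prod.
Qed.

(** * The kernel *)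

Lemma exp_sum_dominates (R : realType) (a b : R) (t : seq R) :
    path >=%R b t ->
    (forall k, 0 <= k -> expR (k * a) <= \sum_(c <- b :: t) expR (k * c)) ->
  a <= b.
Proof.
move=> tb le_a; rewrite leNgt; apply/negP => ba.
have tb' c : c \in b :: t -> c <= b.
  rewrite inE => /predU1P[->//|]; apply/allP: c.
  by apply: order_path_min tb; exact: rev_trans le_trans.
(* All [N] terms are at most [expR (k * b)], so [expR (k * (a - b)) <= N]. This [k] makes the
   exponent equal to [N], against [1 + N <= expR N]. *)
pose N : R := (size (b :: t))%:R; pose k := N / (a - b).
have k0 : 0 <= k by rewrite divr_ge0 ?ler0n// subr_ge0 ltW.
have: expR (k * (a - b)) <= N.
  rewrite mulrBr expRB ler_pdivrMr ?expR_gt0//; apply: le_trans (le_a k k0) _.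
  rewrite /N -sum1_size natr_sum mulr_suml.
  rewrite big_seq [leRHS]big_seq; apply: ler_sum => c /tb' cb.
  by rewrite mul1r ler_expR ler_wpM2l.
apply/negP; rewrite -ltNge; apply: lt_le_trans (expR_ge1Dx _).
by rewrite divfK ?subr_eq0 ?gt_eqF// ltrDr.
Qed.

(** Each leading exponent is bounded by the other, so the heads agree, cancel, and the tails follow
    by induction. At [k = 0] positivity excludes that only one list is empty. *)
Lemma exp_sum_inj (R : realType) (s t : seq R) :
    sorted >=%R s -> sorted >=%R t ->
    (forall k, 0 <= k ->
       \sum_(a <- s) expR (k * a) = \sum_(b <- t) expR (k * b)) ->
  s = t.
Proof.
have pos (c : R) u k : 0 < \sum_(d <- c :: u) expR (k * d).
  by rewrite big_cons ltr_pwDl ?expR_gt0 ?sumr_ge0// => d _; exact: expR_ge0.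
have head (c : R) u k : expR (k * c) <= \sum_(d <- c :: u) expR (k * d).
  by rewrite big_cons lerDl sumr_ge0// => d _; exact: expR_ge0.
elim: s t => [|a s IHs] [|b t] //= sa tb st.
- by have := pos b t 0; rewrite -st// big_nil ltxx.
- by have := pos a s 0; rewrite st// big_nil ltxx.
have ab : a = b.
  apply/eqP; rewrite eq_le (exp_sum_dominates tb) => [|k k0]; last first.
    by rewrite -st.
  by rewrite (exp_sum_dominates sa)// => k k0; rewrite st.
rewrite ab (IHs t) ?(path_sorted sa) ?(path_sorted tb)// => k k0.
by have := st k k0; rewrite !big_cons ab => /addrI.
Qed.

(** The maximum stays and the minimum travels on, so at each point a value is inserted into a
    decreasing list, although the order of [f] and [g] may vary with the point. *)
Fixpoint insert (R : realType) T (f : T -> R) (L : seq (T -> R)) :=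
  if L is g :: L' then
    (fun x => Num.max (f x) (g x)) :: insert (fun x => Num.min (f x) (g x)) L'
  else [:: f].

(* Sorts at all points at once; each swap is the relation
   {f} + {g} = {max(f, g)} + {min(f, g)}. *)
Definition isort (R : realType) T (L : seq (T -> R)) := foldr (@insert R T) [::] L.

Lemma insert_path (R : realType) T (f : T -> R) L x z :
  path >=%R z [seq g x | g <- L] -> f x <= z ->
  path >=%R z [seq g x | g <- insert f L].
Proof.
elim: L f z => [|g L IHL] f z /=; first by move=> _ ->.
move=> /andP[gz gL] fz; rewrite /= ge_max fz gz /=; apply: IHL.
  by case: L gL => //= h L /andP[hg ->]; rewrite le_max hg orbT.
by rewrite ge_min le_max lexx.
Qed.

Lemma isort_sorted (R : realType) T (L : seq (T -> R)) x :
  sorted >=%R [seq g x | g <- isort L].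
Proof.
elim: L => //= f L; case: (isort L) => //= g M gM; apply: insert_path.
  by case: M gM => //= h M /andP[hg ->]; rewrite le_max hg orbT.
by rewrite ge_min le_max lexx.
Qed.

(** * The span of the relations: ideal property and sorting *)

Definition gsum (R : realType) n (X : set 'rV[R]_n) (L : seq (pt X -> R)) :
    (pt X -> R) -> int :=
  fun h => \sum_(f <- L) gbas f h.

Lemma Jspan0 (R : realType) n (X : set 'rV[R]_n) :
  Jspan ((fun=> 0) : (pt X -> R) -> int).
Proof. by exists [::]; split=> //; apply/funext => h; rewrite big_nil. Qed.

Lemma Jspan_gen (R : realType) n (X : set 'rV[R]_n) (c : (pt X -> R) -> int) :
  Jgen c -> Jspan c.
Proof.
move=> cJ; exists [:: (1, c)]; split; first by move=> p [<-|].
by apply/funext => h; rewrite big_seq1 mul1r.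
Qed.

Lemma Jspan_add (R : realType) n (X : set 'rV[R]_n) (a b : (pt X -> R) -> int) :
  Jspan a -> Jspan b -> Jspan (fun h => a h + b h).
Proof.
move=> [s [sJ ->]] [t [tJ ->]]; exists (s ++ t)%list; split.
  by move=> p /List.in_app_iff[/sJ|/tJ].
by apply/funext => h; rewrite big_cat.
Qed.

Lemma Jspan_scale (R : realType) n (X : set 'rV[R]_n) z (a : (pt X -> R) -> int) :
  Jspan a -> Jspan (fun h => z * a h).
Proof.
move=> [s [sJ ->]]; exists (List.map (fun p => (z * p.1, p.2)) s); split.
  by move=> _ /List.in_map_iff[p [<- /sJ]].
apply/funext => h; elim: s {sJ} => [|p s IHs] /=; first by rewrite !big_nil mulr0.
by rewrite !big_cons mulrDr IHs mulrA.
Qed.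

Lemma Jspan_sub (R : realType) n (X : set 'rV[R]_n) (a b : (pt X -> R) -> int) :
  Jspan a -> Jspan b -> Jspan (fun h => a h - b h).
Proof.
move=> aJ bJ; rewrite (_ : (fun _ => _) = fun h => a h + -1 * b h).
  by apply: Jspan_add => //; exact: Jspan_scale.
by apply/funext => h; rewrite mulN1r.
Qed.

(** The shift is multiplication by {f}. Addition distributes over max and min, so generators go to
    generators of the same kind; hence the span is an ideal. *)
Lemma Jgen_shift (R : realType) n (X : set 'rV[R]_n) (f : pt X -> R) c :
  PL f -> Jgen c -> Jgen (fun h => c (fun x => h x - f x)).
Proof.
move=> fPL [[g [k [gPL kPL ->]]]|[g [l [gPL lL ->]]]]; [left|right].
  exists (fun x => f x + g x), (fun x => f x + k x); split; [exact: PL_add..|].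
  apply/funext => h; rewrite !gbas_shift; congr (_ - gbas _ h - gbas _ h);
    apply/funext => x; [exact: addr_maxr | exact: addr_minr].
exists (fun x => f x + g x), l; split=> //; first exact: PL_add.
apply/funext => h; rewrite !gbas_shift; congr (gbas _ h - _).
by apply/funext => x; rewrite addrA.
Qed.

Lemma Jspan_shift (R : realType) n (X : set 'rV[R]_n) (f : pt X -> R) a :
  PL f -> Jspan a -> Jspan (fun h => a (fun x => h x - f x)).
Proof.
move=> fPL [s [sJ ->]].
exists (List.map (fun p => (p.1, fun h => p.2 (fun x => h x - f x))) s); split.
  by move=> _ /List.in_map_iff[p [<- /sJ]]; exact: Jgen_shift.
apply/funext => h; elim: s {sJ} => [|p s IHs] /=; first by rewrite !big_nil.
by rewrite !big_cons IHs.
Qed.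

Lemma Jspan_prod (R : realType) n (X : set 'rV[R]_n) (s t : seq (int * (pt X -> R))) :
  PLs s -> Jspan (gcomb t) -> Jspan (gcomb (gprod s t)).
Proof.
move=> sPL tJ; rewrite (funext (gcomb_prod s t)).
elim: s sPL => [_|p s IHs sPL].
  by under eq_fun do rewrite big_nil; exact: Jspan0.
under eq_fun do rewrite big_cons.
apply: Jspan_add; first by apply/Jspan_scale/Jspan_shift => //; exact/sPL/mem_head.
by apply: IHs => q qs; apply: sPL; rewrite inE qs orbT.
Qed.

Lemma insert_PL (R : realType) n (X : set 'rV[R]_n) (f : pt X -> R) L :
  PL f -> (forall g, g \in L -> PL g) -> forall g, g \in insert f L -> PL g.
Proof.
elim: L f => [|g L IHL] f fPL LPL h /=; first by rewrite inE => /eqP ->.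
have gPL : PL g by exact/LPL/mem_head.
rewrite inE => /predU1P[->|]; first exact: PL_max.
by apply: IHL; [exact: PL_min | move=> k kL; apply: LPL; rewrite inE kL orbT].
Qed.

Lemma isort_PL (R : realType) n (X : set 'rV[R]_n) (L : seq (pt X -> R)) :
  (forall g, g \in L -> PL g) -> forall g, g \in isort L -> PL g.
Proof.
elim: L => //= f L IHL LPL; apply: insert_PL; first exact/LPL/mem_head.
by apply: IHL => g gL; apply: LPL; rewrite inE gL orbT.
Qed.

Lemma gsum_insert (R : realType) n (X : set 'rV[R]_n) (f : pt X -> R) L :
  PL f -> (forall g, g \in L -> PL g) ->
  Jspan (fun h => gsum (f :: L) h - gsum (insert f L) h).
Proof.
elim: L f => [|g L IHL] f fPL LPL /=.
  by under eq_fun do rewrite subrr; exact: Jspan0.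
have gPL : PL g by exact/LPL/mem_head.
pose M x := Num.max (f x) (g x); pose m x := Num.min (f x) (g x).
(* One max-min relation replaces [f] and [g] by [M] and [m]; inserting [m] into the tail is the
   induction hypothesis. *)
rewrite (_ : (fun _ => _) = fun h =>
  (gbas f h + gbas g h - gbas M h - gbas m h) +
  (gsum (m :: L) h - gsum (insert m L) h)).
  apply: Jspan_add; first by apply: Jspan_gen; left; exists f, g.
  by apply: IHL; [exact: PL_min | move=> k kL; apply: LPL; rewrite inE kL orbT].
by apply/funext => h; rewrite /gsum !big_cons; ring.
Qed.

Lemma gsum_isort (R : realType) n (X : set 'rV[R]_n) (L : seq (pt X -> R)) :
  (forall g, g \in L -> PL g) -> Jspan (fun h => gsum L h - gsum (isort L) h).
Proof.
elim: L => [|f L IHL] LPL /=.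
  by under eq_fun do rewrite subrr; exact: Jspan0.
have fPL : PL f by exact/LPL/mem_head.
have LPL' g : g \in L -> PL g by move=> gL; apply: LPL; rewrite inE gL orbT.
rewrite (_ : (fun _ => _) = fun h => (gsum L h - gsum (isort L) h) +
  (gsum (f :: isort L) h - gsum (insert f (isort L)) h)).
  by apply: Jspan_add; [exact: IHL | apply: gsum_insert => //; exact: isort_PL].
by apply/funext => h; rewrite /gsum !big_cons; ring.
Qed.

Lemma exp_insert (R : realType) T (f : T -> R) L k x : 0 <= k ->
  \sum_(g <- insert f L) expR (k * g x) = expR (k * f x) + \sum_(g <- L) expR (k * g x).
Proof.
move=> k0; elim: L f => [|g L IHL] f /=; first by rewrite big_seq1 big_nil addr0.
rewrite !big_cons IHL !addrA; congr (_ + _).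
by case: leP => // _; rewrite addrC.
Qed.

Lemma exp_isort (R : realType) T (L : seq (T -> R)) k x : 0 <= k ->
  \sum_(g <- isort L) expR (k * g x) = \sum_(g <- L) expR (k * g x).
Proof.
by move=> k0; elim: L => //= f L IHL; rewrite exp_insert// IHL big_cons.
Qed.

(** A point is needed to compare the lengths: over an empty [S] the hypothesis is vacuous. *)
Lemma eq_maps (S T : Type) (L M : seq (S -> T)) : inhabited S ->
  (forall x, [seq g x | g <- L] = [seq g x | g <- M]) -> L = M.
Proof.
move=> [x0]; elim: L M => [|f L IHL] [|g M] LM //; try by have := LM x0.
congr cons; first by apply/funext => x; case: (LM x).
by apply: IHL => x; case: (LM x).
Qed.

Lemma gcomb_gsum (R : realType) n (X : set 'rV[R]_n) (s : seq (int * (pt X -> R))) :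
  PLs s -> exists P Q : seq (pt X -> R), [/\
    forall f, f \in P -> PL f, forall f, f \in Q -> PL f,
    gcomb s = (fun h => gsum P h - gsum Q h) &
    ecomb s = (fun x => \sum_(f <- P) expR (f x) - \sum_(f <- Q) expR (f x))].
Proof.
elim: s => [_|[z f] s IHs sPL].
  exists [::], [::]; split=> //; apply/funext => h;
    by rewrite /gcomb /ecomb /gsum !big_nil subrr.
have [|P [Q [PPL QPL gs es]]] := IHs.
  by move=> q qs; apply: sPL; rewrite inE qs orbT.
have fPL : PL f by exact: (sPL _ (mem_head _ _)).
have catPL k (L : seq (pt X -> R)) : (forall g, g \in L -> PL g) ->
    forall g, g \in nseq k f ++ L -> PL g.
  by move=> LPL g; rewrite mem_cat => /orP[/nseqP[-> _]|/LPL].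
have gcat k L h : gsum (nseq k f ++ L) h = k%:Z * gbas f h + gsum L h.
  by rewrite /gsum big_cat big_nseq iter_addr_0 -mulr_natl natz.
have ecat k L x : \sum_(g <- nseq k f ++ L) expR (g x) =
    k%:R * expR (f x) + \sum_(g <- L) expR (g x).
  by rewrite big_cat big_nseq iter_addr_0 mulr_natl.
(* [Negz k] is [- (k + 1)], hence [k.+1] copies on the negative side. *)
case: z {sPL} => k; [exists (nseq k f ++ P), Q | exists P, (nseq k.+1 f ++ Q)];
  split; do ?[exact: catPL | by []]; apply/funext => h;
  rewrite ?gcat ?ecat /gcomb /ecomb big_cons /=.
- by rewrite -[X in _ + X]/(gcomb s h) gs addrA.
- by rewrite -[X in _ + X]/(ecomb s h) es addrA.
- by rewrite -[X in _ + X]/(gcomb s h) gs NegzE; ring.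
- by rewrite -[X in _ + X]/(ecomb s h) es NegzE mulrNz; ring.
Qed.

(* By homogeneity, rescaling a point turns a vanishing exponential sum into a
   one-parameter family, from which [exp_sum_inj] reads off the exponents. *)
Lemma ecomb_eq0 (R : realType) n (X : set 'rV[R]_n) (s : seq (int * (pt X -> R))) :
  is_fan_support X -> PLs s -> ecomb s = (fun=> 0) -> Jspan (gcomb s).
Proof.
move=> Xfan sPL s0; have [P [Q [PPL QPL gs es]]] := gcomb_gsum sPL.
have eqPQ : isort P = isort Q.
  apply: eq_maps => [|x]; first by constructor; exists 0; exact: fan_support0.
  apply: exp_sum_inj; [exact: isort_sorted..|] => k k0.
  rewrite !big_map !exp_isort//.
  have Xkx := fan_support_scale Xfan k0 (svalP x).
  pose y : pt X := exist _ _ Xkx.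
  have yE L : (forall f, f \in L -> PL f) ->
      \sum_(g <- L) expR (k * g x) = \sum_(g <- L) expR (g y).
    move=> LPL; rewrite big_seq [RHS]big_seq; apply: eq_bigr => g /LPL gPL.
    by rewrite (PL_homog (x := x) (y := y) gPL k0).
  rewrite !yE//; apply/eqP; rewrite -subr_eq0.
  by have := congr1 (@^~ y) es; rewrite s0 => /= <-.
(* [P] and [Q] are congruent modulo the relations to the same sorted list. *)
rewrite gs (_ : (fun _ => _) = fun h =>
  (gsum P h - gsum (isort P) h) - (gsum Q h - gsum (isort Q) h)).
  by apply: Jspan_sub; exact: gsum_isort.
by apply/funext => h; rewrite eqPQ; ring.
Qed.

(** At each point max and min permute the two values, so the first relation evaluates to 0; the
    second evaluates to [e^f (e^l - 1)]. *)
Lemma Jgen_ecomb (R : realType) n (X : set 'rV[R]_n) (c : (pt X -> R) -> int)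
    (S : set (pt X -> R)) :
    PE_ideal S -> (forall l, Lin l -> S (fun x => expR (l x) - 1)) -> Jgen c ->
  exists2 s, c = gcomb s & S (ecomb s).
Proof.
move=> [SPE S0 SB SM] Sl [[f [g [fPL gPL ->]]]|[f [l [fPL lL ->]]]].
  pose M x := Num.max (f x) (g x); pose m x := Num.min (f x) (g x).
  exists [:: (1, f); (1, g); (-1, M); (-1, m)].
    by apply/funext => h; rewrite /gcomb !big_cons big_nil /=; ring.
  rewrite (_ : ecomb _ = fun=> 0)//; apply/funext => x.
  rewrite /ecomb !big_cons big_nil /= /M /m mulrN1z !mul1r !mulN1r.
  by case: leP => _; ring.
exists [:: (1, (fun x => f x + l x)); (-1, f)].
  by apply/funext => h; rewrite /gcomb !big_cons big_nil /=; ring.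
rewrite (_ : ecomb _ = fun x => fexp f x * (expR (l x) - 1)).
  by apply: SM; [move=> ? _; apply | exact: Sl].
apply/funext => x; rewrite /ecomb !big_cons big_nil /= expRD /fexp mulrN1z.
by rewrite mul1r addr0 mulN1r mulrBr mulr1.
Qed.

Lemma Jspan_PE_I (R : realType) n (X : set 'rV[R]_n) (a : (pt X -> R) -> int) :
  Jspan a -> PE_I (phi a).
Proof.
move=> [s [sJ ->]] S Sid Sl; have [SPE S0 SB SM] := Sid.
(* A list of terms {f} in place of a combination of generators makes [phi] computable by
   [phi_gcomb]. *)
suff [t -> St] : exists2 t,
    (fun h => \sum_(p <- s) p.1 * p.2 h) = gcomb t & S (ecomb t).
  by rewrite phi_gcomb.
elim: s sJ => [_|[z c] s IHs sJ].
  exists [::]; first by apply/funext => h; rewrite /gcomb !big_nil.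
  by rewrite (_ : ecomb _ = fun=> 0)//; apply/funext => x; rewrite /ecomb big_nil.
have [|t tE St] := IHs; first by move=> p ps; apply: sJ; right.
have [u cE Su] := Jgen_ecomb Sid Sl (sJ _ (or_introl erefl)).
exists (gscale z u ++ t).
  apply/funext => h; rewrite gcomb_cat gcomb_scale big_cons /= -tE.
  by rewrite -[c]/((z, c).2) cE.
rewrite (_ : ecomb _ = fun x => z%:~R * ecomb u x + ecomb t x).
  by apply: subr_closed_add => //; exact: subring_int.
by apply/funext => x; rewrite ecomb_cat ecomb_scale.
Qed.

(** The values of elements of the span form an ideal [S] of [PE] containing every [e^l - 1], so
    [phi a] is the value of some [t] in the span. *)
Lemma PE_I_Jspan (R : realType) n (X : set 'rV[R]_n) (a : (pt X -> R) -> int) :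
  is_fan_support X -> grp a -> PE_I (phi a) -> Jspan a.
Proof.
move=> Xfan /grp_gcomb[s sPL ->]; rewrite phi_gcomb.
pose S := [set F : pt X -> R |
  exists t, [/\ PLs t, Jspan (gcomb t) & F = ecomb t]].
have PL0 : PL ((fun=> 0) : pt X -> R) by apply: Lin_PL => //; exact: Lin0.
move=> /(_ S)[||t [tPL tJ stE]].
- split.
  + by move=> _ [t [tPL _ ->]]; exact: ecomb_PE.
  + exists [::]; split=> //.
      rewrite (_ : gcomb _ = fun=> 0); first exact: Jspan0.
      by apply/funext => h; rewrite /gcomb big_nil.
    by apply/funext => h; rewrite /ecomb big_nil.
  + move=> _ _ [t [tPL tJ ->]] [u [uPL uJ ->]]; exists (t ++ gscale (-1) u); split.
    * by apply: PLs_cat => //; exact: PLs_scale.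
    * rewrite (_ : gcomb _ = fun h => gcomb t h - gcomb u h); first exact: Jspan_sub.
      by apply/funext => h; rewrite gcomb_cat gcomb_scale mulN1r.
    * by apply/funext => h; rewrite ecomb_cat ecomb_scale mulN1r.
  + move=> _ _ /(PE_ecomb Xfan)[t tPL ->] [u [uPL uJ ->]]; exists (gprod t u); split.
    * exact: PLs_prod.
    * exact: Jspan_prod.
    * by apply/funext => x; rewrite ecomb_prod.
(* [e^l - 1] is the value of {l} - {0}, the translation relation at [f = 0]. *)
- move=> l lL; exists [:: (1, l); (-1, fun=> 0)]; split.
  + by move=> p; rewrite !inE => /orP[] /eqP -> //; exact: Lin_PL.
  + apply: Jspan_gen; right; exists (fun=> 0), l; split=> //.
    apply/funext => h; rewrite /gcomb !big_cons big_nil /= mul1r mulN1r addr0.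
    by congr (gbas _ h - _); apply/funext => x; rewrite add0r.
  + apply/funext => x; rewrite /ecomb !big_cons big_nil /= mul1r mulrN1z mulN1r.
    by rewrite addr0 expR0.
(* [s] and [t] have equal values, so their difference is a vanishing exponential sum; adding [t]
   back recovers [s]. *)
have : Jspan (gcomb (s ++ gscale (-1) t)).
  apply: ecomb_eq0 => //; first by apply: PLs_cat => //; exact: PLs_scale.
  by apply/funext => x; rewrite ecomb_cat ecomb_scale stE mulN1r subrr.
move=> /Jspan_add/(_ tJ); congr Jspan; apply/funext => h.
by rewrite gcomb_cat gcomb_scale mulN1r subrK.
Qed.

Theorem theorem2 (R : realType) (n : nat) (X : set 'rV[R]_n) :
  is_fan_support X ->
  (* phi is a ring homomorphism Z{PL(X)} -> PE(X), {f} |-> e^f *)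
  (forall f : pt X -> R, PL f -> phi (gbas f) = fexp f) /\
  (forall a : (pt X -> R) -> int, grp a -> PE (phi a)) /\
  phi (gbas ((fun=> 0) : pt X -> R)) = (fun=> 1) /\
  (forall a b : (pt X -> R) -> int, grp a -> grp b -> phi (gadd a b) = (fun x => phi a x + phi b x)) /\
  (forall a b : (pt X -> R) -> int, grp a -> grp b -> phi (gmul a b) = (fun x => phi a x * phi b x)) /\
  (* surjectivity onto PE(X) modulo the ideal <e^l - 1> *)
  (forall F : pt X -> R, PE F -> exists a, grp a /\ PE_I (fun x => F x - phi a x)) /\
  (* the kernel of Z{PL(X)} -> PE_underline(X) is exactly J *)
  (forall a : (pt X -> R) -> int, grp a -> (PE_I (phi a) <-> Jspan a)).
Proof.
move=> Xfan.
have phi_gbas (f : pt X -> R) : phi (gbas f) = fexp f.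
  rewrite -gcomb1 phi_gcomb; apply/funext => x.
  by rewrite /ecomb big_seq1 mul1r.
split; first by move=> f _; exact: phi_gbas.
split; first by move=> a /grp_gcomb[s sPL ->]; rewrite phi_gcomb; exact: ecomb_PE.
split; first by rewrite phi_gbas; apply/funext => x; rewrite /fexp expR0.
split=> [a b /grp_gcomb[s _ ->] /grp_gcomb[t _ ->]|].
  rewrite (_ : gadd _ _ = gcomb (s ++ t)) ?phi_gcomb.
    by apply/funext => x; rewrite ecomb_cat.
  by apply/funext => h; rewrite gcomb_cat.
split=> [a b /grp_gcomb[s _ ->] /grp_gcomb[t _ ->]|].
  by rewrite gmul_gcomb !phi_gcomb; apply/funext => x; rewrite ecomb_prod.
split=> [F /(PE_ecomb Xfan)[s sPL ->]|].
  exists (gcomb s); split; first exact: gcomb_grp.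
  (* [phi] already reaches [F] itself, so the difference is zero and lies in every ideal. *)
  rewrite phi_gcomb => S [_ S0 _ _] _.
  by rewrite (_ : (fun _ => _) = fun=> 0)//; apply/funext => x; rewrite subrr.
by move=> a aG; split; [exact: PE_I_Jspan | exact: Jspan_PE_I].
Qed.
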